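(* Let $\mathbb{X}$ be a finite-dimensional Euclidean space and let $\varphi:\mathbb{X}\to\mathbb{R}\cup\{+\infty\}$ be a proper lower semicontinuous convex function. Suppose that $\bar x$ is a minimizer of $\varphi$. Then $\bar x$ is a tilt-stable solution of the problem $\min_{x\in\mathbb{X}}\varphi(x)$ if and only if there exist $\ell>0$ and an open neighborhood $U\times V\subset\mathbb{X}\times\mathbb{X}^*$ of $(\bar x,0)$ such that $$d^2\varphi(u|v)(w)\ge\ell\|w\|^2\quad\text{whenever } (u,v)\in\mathrm{gph}\,\partial\varphi\cap(U\times V)\text{ and } w\in\mathbb{X}.$$
   Context: $\partial\varphi$ is the convex subdifferential and $\mathrm{gph}\,\partial\varphi=\{(u,v):v\in\partial\varphi(u)\}$. Second subderivative: for $v\in\partial\varphi(u)$ and $w\in\mathbb{X}$, $$d^2\varphi(u|v)(w)=\liminf_{t\downarrow0,\;w'\to w}\frac{\varphi(u+tw')-\varphi(u)-t\langle v,w'\rangle}{\frac12t^2}.$$ Tilt stability: $\bar x$ is a tilt-stable solution of $\min\varphi$ if there is $\gamma>0$ such that the mapping $M_\gamma(v)=\mathrm{argmin}\{\varphi(x)-\langle v,x\rangle: x\in\mathbb{B}_\gamma(\bar x)\}$ is single-valued and Lipschitz continuous on some neighborhood of $0\in\mathbb{X}^*$ with $M_\gamma(0)=\bar x$, where $\mathbb{B}_\gamma(\bar x)$ is the open ball of radius $\gamma$ around $\bar x$. *)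

(* Defs.v *)
From HB Require Import structures.
From mathcomp Require Import all_boot all_order all_algebra sesquilinear.
From mathcomp Require Import boolp classical_sets reals ereal topology normedtype.

Set Implicit Arguments.
Unset Strict Implicit.
Unset Printing Implicit Defensive.

Import Order.TTheory GRing.Theory Num.Theory.
Import numFieldNormedType.Exports.

Local Open Scope classical_set_scope.
Local Open Scope ring_scope.

#[short(type="normedVectType")]
HB.structure Definition NormedVector (K : numFieldType) :=
  {T of NormedModule K T & Vector K T}.

Section Defs.
Context {R : realType} {X : normedVectType R}.
Implicit Types (dot : {dot X for idfun}) (phi : X -> \bar R).
Implicit Types (u v w x y : X) (gamma : R).

(* [dot] is the inner product inducing the norm of [X], so that [X] is a
   finite-dimensional Euclidean space; its dual is identified with [X], the
   functional attached to [v : X] being [dot v]. *)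
Definition euclidean_dot dot := forall x, `|x| ^+ 2 = dot x x.

Definition proper_fun phi :=
  (forall x, (-oo < phi x)%E) /\ (exists x, (phi x < +oo)%E).

Definition econvex phi := forall x y (t : R), 0 < t < 1 ->
  (phi (t *: x + (1 - t) *: y)%R <= t%:E * phi x + (1 - t)%:E * phi y)%E.

Definition minimizer phi x := forall y, (phi x <= phi y)%E.

Definition subdifferential dot phi u : set X :=
  [set v | phi u \is a fin_num /\
           forall x, (phi u + (dot v (x - u)%R)%:E <= phi x)%E].

Definition gph_subdifferential dot phi : set (X * X) :=
  [set uv | subdifferential dot phi uv.1 uv.2].

Definition second_subderivative dot phi u v w : \bar R :=
  limf_einf
    (fun p : R * X =>
       ((phi (u + p.1 *: p.2)%R - phi u - (p.1 * dot v p.2)%:E)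
        * ((2^-1 * p.1 ^+ 2)^-1)%:E)%E)
    (filter_prod (0:R)^'+ (nbhs w)).

Definition tilt_argmin dot phi x0 gamma v : set X :=
  [set x | ball x0 gamma x /\
     forall y, ball x0 gamma y ->
       (phi x - (dot v x)%:E <= phi y - (dot v y)%:E)%E].

Definition tilt_stable dot phi x0 := exists2 gamma : R, 0 < gamma &
  tilt_argmin dot phi x0 gamma 0 = [set x0] /\
  exists2 N : set X, nbhs 0 N &
  exists2 m : X -> X,
    (forall v, N v -> tilt_argmin dot phi x0 gamma v = [set m v]) &
    [lipschitz m v | v in N].

End Defs.

(* Main.v *)
Require Import Defs.
From HB Require Import structures.
From mathcomp Require Import all_boot all_order all_algebra vector sesquilinear.
From mathcomp Require Import boolp classical_sets reals ereal topology normedtype.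
From mathcomp Require Import derive ring lra.

Set Implicit Arguments.
Unset Strict Implicit.
Unset Printing Implicit Defensive.

Import Order.TTheory GRing.Theory Num.Theory.
Import numFieldNormedType.Exports.

Local Open Scope classical_set_scope.
Local Open Scope ring_scope.

(** Both properties are compared with a third one, uniform quadratic growth:
    there is one constant [c > 0] such that, for all [(u, v)] in the graph of
    the subdifferential near [(xbar, 0)],
    [phi x >= phi u + <v, x - u> + c |x - u|^2] for [x] close to [u], where how
    close may depend on [(u, v)].

    Growth and second subderivative.  Growth with constant [c] bounds the
    difference quotients from below by [2 c |w'|^2], hence the lower limit by
    [2 c |w|^2].  Conversely a bound [l |w|^2] on the lower limit gives, for
    each unit [w], a bound [l / 2] on the quotients at all small steps and all
    directions near [w]; as the unit sphere is compact, one step size serves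
    all directions, which is growth with constant [l / 4].

    From tilt stability to growth
    ([tilt_stable_uniform_quadratic_growth]).  By convexity the minimizer of a
    tilted function over a ball minimizes it globally, so near [(xbar, 0)] the
    inverse of the subdifferential is the Lipschitz map [m].  Adding the
    subgradient inequalities at [u = m v] and at [m (v + d)] gives
    [phi x >= phi u + <v, x - u> + <d, x - u> - k |d|^2], and the best [d],
    a multiple of [x - u], turns the last two terms into
    [|x - u|^2 / (4 k)].

    From growth to tilt stability ([uniform_quadratic_growth_tilt_stable]).
    Convexity extends quadratic growth near [u] to linear growth away from [u].
    This makes every slightly tilted function attain its minimum
    ([quadratic_growth_subdifferential_onto]) and forces the new minimizers to
    lie within [c^-1 |v' - v|] of [u] ([quadratic_growth_calm]).  The solution
    map is therefore single-valued and, at each [v], calm with the constant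
    [c^-1] on a neighborhood whose size is not controlled; along segments such
    a pointwise estimate adds up to a Lipschitz estimate with the same constant
    ([klipschitz_of_pointwise]). *)

(** * Compactness in finite dimension *)

Section Compactness.
Context {R : realType} {X : normedVectType R}.

Lemma vecof_continuous (e : (\dim {:X}).-tuple X) :
  continuous (passmx.vecof e).
Proof.
apply: continuous_big; first exact: add_continuous.
move=> i _ v.
apply: (@cvgZr_tmp _ _ _ (nbhs v) _ (fun a : 'rV_(\dim {:X}) => a 0 i)).
exact: coord_continuous.
Qed.

(** The coordinate map [f] of a basis satisfies [c |a| <= |f a|], [c] being the
    minimum of [|f a|] on the unit sphere of the coordinate space, so [A] is the
    image of a closed bounded set of coordinates. *)
Lemma vect_bounded_closed_compact (A : set X) :
  bounded_set A -> closed A -> compact A.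
Proof.
move=> bA cA; pose e := vbasis {:X}; have eb := vbasisP {:X}.
pose f := passmx.vecof e; have fc : continuous f := @vecof_continuous e.
suff [c c0 cP] : exists2 c : R, 0 < c & forall a, c * `|a| <= `|f a|.
  have -> : A = f @` (f @^-1` A).
    rewrite image_preimage// eqEsubset; split => // x _.
    by exists (passmx.rVof e x) => //; exact: passmx.rVofK.
  apply: continuous_compact; first exact: continuous_subspaceT.
  apply: bounded_closed_compact; last first.
    by apply: closed_comp => // x _; exact: fc.
  have [M [_ MP]] := bA.
  exists (c^-1 * (M + 1)); split; first exact: num_real.
  move=> r /ltW rM a Aa; apply: le_trans rM.
  rewrite ler_pdivlMl//; apply: (le_trans (cP a)).
  by apply: MP => //; rewrite ltrDl.
pose S : set 'rV[R]_(\dim {:X}) := [set a | `|a| = 1].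
have normS (a : 'rV[R]_(\dim {:X})) : a != 0 -> S (`|a|^-1 *: a).
  by move=> a0; rewrite /S /= normrZ normfV normr_id mulVf// normr_eq0.
(* The unit sphere is empty when [X] is trivial. *)
have [S0|/nonemptyPn S0] := pselect (S !=set0); last first.
  exists 1 => // a; have [->|/normS] := eqVneq a 0; last by rewrite S0.
  by rewrite normr0 mulr0.
have cS : compact S.
  apply: bounded_closed_compact.
    exists 1; split; first exact: num_real.
    by move=> r /ltW r1 a /= ->.
  apply: (@closed_comp _ _ (fun a : 'rV[R]_(\dim {:X}) => `|a|) [set 1]).
    by move=> a _; exact: norm_continuous.
  exact: closed_eq.
have [b bS bmin] : exists2 b, b \in S & forall a, a \in S -> `|f b| <= `|f a|.
  apply: EVT_min_rV => //; apply: continuous_subspaceT => a.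
  apply: continuous_comp; [exact: fc|exact: norm_continuous].
exists `|f b|.
  rewrite normr_gt0 passmx.vecof_eq0//.
  apply: contraTneq bS => ->; rewrite notin_setE /S /= normr0 => /esym/eqP.
  by rewrite oner_eq0.
move=> a; have [->|a0] := eqVneq a 0; first by rewrite normr0 mulr0.
have := bmin _ (mem_set (normS _ a0)).
have fZ k x : f (k *: x) = k *: f x.
  rewrite /f /passmx.vecof scaler_sumr; apply: eq_bigr => i _.
  by rewrite mxE scalerA.
rewrite fZ normrZ normfV normr_id ler_pdivlMl ?normr_gt0//.
by rewrite mulrC.
Qed.

Lemma compact_closed_ball (u : X) (r : R) : compact [set x | `|x - u| <= r].
Proof.
apply: vect_bounded_closed_compact.
  exists (r + `|u|); split; first exact: num_real.
  move=> s /ltW rs x /= xr; apply: le_trans rs.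
  by rewrite -{1}(subrK u x) (le_trans (ler_normD _ _))// lerD2r.
apply: (@closed_comp _ _ (fun x : X => `|x - u|) [set t | t <= r]).
  move=> a _; apply: (@continuous_comp _ _ _ (fun x : X => x - u)).
    by apply: cvgB; [exact: cvg_id|exact: cvg_cst].
  exact: norm_continuous.
exact: closed_le.
Qed.

Lemma compact_unit_sphere : compact [set x : X | `|x| = 1].
Proof.
apply: (@subclosed_compact _ _ [set x : X | `|x - 0| <= 1]).
- apply: (@closed_comp _ _ (fun x : X => `|x|) [set 1]); last exact: closed_eq.
  by move=> a _; exact: norm_continuous.
- exact: compact_closed_ball.
- by move=> x x1; rewrite /= subr0 [X in X <= _]x1.
Qed.

End Compactness.

(** * Lower semicontinuous functions *)

Section Lsc.
Context {R : realType} {T : topologicalType}.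

(** The sublevel sets at the values of [f] on [K] form a filter; by lower
    semicontinuity [f] cannot take a smaller value on [K] than at a cluster
    point of it. *)
Lemma lower_semicontinuous_compact_min (f : T -> \bar R) (K : set T) :
  lower_semicontinuous f -> compact K -> K !=set0 ->
  exists2 x, K x & forall y, K y -> (f x <= f y)%E.
Proof.
move=> lsc cK [y0 Ky0].
pose L y := [set x | K x /\ (f x <= f y)%E].
have FF : ProperFilter (filter_from K L).
  apply: filter_from_proper; last by move=> y Ky; exists y; split.
  apply: filter_from_filter; first by exists y0.
  move=> y z Ky Kz.
  have [yz|/ltW zy] := leP (f y) (f z).
    by exists y => // x [Kx xy]; split; split => //; exact: le_trans yz.
  by exists z => // x [Kx xz]; split; split => //; exact: le_trans zy.
have FK : filter_from K L K by exists y0 => // x [].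
have [x [Kx clx]] := cK _ FF FK.
exists x => // y Ky; rewrite leNgt; apply/negP => fyx.
(* [a] is needed because [f y] may be [-oo]. *)
have [a fya afx] : exists2 a : R, (f y <= a%:E)%E & (a%:E < f x)%E.
  case: (f y) fyx => [r rx| |]; first by exists r.
    by rewrite ltNge leey.
  case: (f x) => [p _| _|]//; last by exists 0; rewrite ?leNye ?ltry.
  by exists (p - 1); rewrite ?leNye// lte_fin gtrBl.
have [V nV Va] := lsc x a afx.
have [z [[_ zy] Vz]] : (L y `&` V) !=set0.
  by apply: clx => //; exists y.
by have := lt_le_trans (Va z Vz) (le_trans zy fya); rewrite ltxx.
Qed.

Lemma lower_semicontinuousB (f : T -> \bar R) (g : T -> R) :
  lower_semicontinuous f -> continuous g ->
  lower_semicontinuous (fun x => f x - (g x)%:E)%E.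
Proof.
move=> lsc cg x a; rewrite lteBrDr// -EFinD => afx.
have [b ab bfx] : exists2 b : R, a + g x < b & (b%:E < f x)%E.
  case: (f x) afx => [p| |] //; last first.
    by exists (a + g x + 1); rewrite ?ltry// ltrDl.
  rewrite lte_fin => ap; exists ((a + g x + p) / 2); first lra.
  by rewrite lte_fin; lra.
have [V nV Vb] := lsc x b bfx.
have gxb : g x < b - a by lra.
exists (V `&` [set y | g y < b - a]).
  by apply: filterI => //; exact: (cvgr_lt _ (cg x) _ gxb).
move=> y [/Vb bfy gyb]; rewrite lteBrDr// -EFinD.
by apply: lt_trans bfy; rewrite lte_fin; move: gyb => /=; lra.
Qed.

End Lsc.

(** * From pointwise to Lipschitz estimates *)

(** The parameters [t] for which the estimate holds between [x] and the point
    [p t] of the segment from [x] to [y] have a supremum; the estimate passes to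
    the supremum, and beyond it unless it is [1]. *)
Lemma klipschitz_of_pointwise {R : realType} {V W : normedModType R}
    (m : V -> W) (K : R) (N : set V) :
  0 <= K ->
  (forall x y (t : R), N x -> N y -> 0 <= t <= 1 -> N (x + t *: (y - x))) ->
  (forall x, N x -> exists2 e : R, 0 < e &
     forall y, N y -> `|y - x| < e -> `|m y - m x| <= K * `|y - x|) ->
  forall x y, N x -> N y -> `|m y - m x| <= K * `|y - x|.
Proof.
move=> K0 cN calm x y Nx Ny.
pose p (t : R) := x + t *: (y - x).
pose S := [set t : R | 0 <= t <= 1 /\ `|m (p t) - m x| <= K * (t * `|y - x|)].
set D := `|y - x| in S *; have D0 : 0 <= D by exact: normr_ge0.
have S0 : S 0.
  split; first by rewrite lexx ler01.
  by rewrite /p scale0r addr0 subrr normr0 mul0r mulr0.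
have ubS : ubound S 1 by move=> t [/andP[]].
have supS : has_sup S by split; [exists 0|exists 1].
have s0 : 0 <= sup S by apply: sup_upper_bound.
have s1 : sup S <= 1 by apply: sup_le_ub => //; exists 0.
have pB s t : `|p s - p t| = `|s - t| * D.
  by rewrite /p opprD addrACA subrr add0r -scalerBl normrZ.
have Np t : 0 <= t <= 1 -> N (p t) by exact: cN.
have [e e0 calme] := calm (p (sup S)) (Np _ (introT andP (conj s0 s1))).
have D1 : 0 < D + 1 by lra.
pose d := e / (D + 1); have d0 : 0 < d by rewrite divr_gt0.
have dD : d * (D + 1) = e by rewrite divfK// gt_eqF.
have calmd t : 0 <= t <= 1 -> `|t - sup S| < d ->
    `|m (p t) - m (p (sup S))| <= K * (`|t - sup S| * D).
  move=> t01 td; rewrite -pB; apply: calme; first exact: Np.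
  by rewrite pB; nra.
have [s [s01 sK] sd] := sup_adherent d0 supS.
have ss : s <= sup S by apply: sup_upper_bound.
have supK : `|m (p (sup S)) - m x| <= K * (sup S * D).
  have := calmd s s01; rewrite distrC ger0_norm ?subr_ge0//.
  move=> /(_ ltac:(lra)).
  have := ler_distD (m (p s)) (m (p (sup S))) (m x).
  by rewrite (distrC (m (p (sup S))) (m (p s))); nra.
have [s1'|s1'] := ltP (sup S) 1; last first.
  have E : sup S = 1 by apply/eqP; rewrite eq_le s1.
  have p1 : p 1 = y by rewrite /p scale1r addrC subrK.
  by move: supK; rewrite E mul1r p1.
pose t := Num.min 1 (sup S + d / 2).
have [t1 td st] : [/\ t <= 1, t - sup S < d & sup S < t].
  rewrite /t; have [h|h] := leP 1 (sup S + d / 2); split; lra.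
suff /(sup_upper_bound supS) : S t by rewrite leNgt st.
have t01 : 0 <= t <= 1 by apply/andP; split => //; lra.
split => //.
have := calmd t t01; rewrite gtr0_norm ?subr_gt0// => /(_ td).
have := ler_distD (m (p (sup S))) (m (p t)) (m x).
nra.
Qed.

(** * The inner product *)

Section Euclidean.
Context {R : realType} {X : normedVectType R}.
Variables (dot : {dot X for idfun}) (dotE : euclidean_dot dot).
Implicit Types (phi : X -> \bar R) (c e : R) (u v w x y z : X).

Lemma dotC x y : dot x y = dot y x.
Proof. by rewrite hermC /= expr0 mul1r. Qed.

Lemma dotBl x y z : dot (x - y) z = dot x z - dot y z.
Proof. by rewrite linearBl. Qed.

Lemma dotBr x y z : dot z (x - y) = dot z x - dot z y.
Proof. by rewrite linearBr. Qed.

Lemma dotDl x y z : dot (x + y) z = dot x z + dot y z.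
Proof. by rewrite linearDl. Qed.

Lemma dotZl a x y : dot (a *: x) y = a * dot x y.
Proof. by rewrite linearZl_LR. Qed.

Lemma dotZr a x y : dot x (a *: y) = a * dot x y.
Proof. by rewrite dotC dotZl dotC. Qed.

Lemma dotNr x y : dot x (- y) = - dot x y.
Proof. by rewrite linearNr. Qed.

Lemma dot_norm x : dot x x = `|x| ^+ 2.
Proof. by rewrite -dotE. Qed.

(** Cauchy-Schwarz is here the triangle inequality, squared. *)
Lemma euclidean_dot_le x y : dot x y <= `|x| * `|y|.
Proof.
have : `|x + y| ^+ 2 <= (`|x| + `|y|) ^+ 2.
  by rewrite ler_pXn2r// ?nnegrE ?addr_ge0//; exact: ler_normD.
rewrite -dot_norm linearDl !linearDr/= !dot_norm (dotC y x) => H.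
nra.
Qed.

Lemma dot_continuous v : continuous (dot v : X -> R).
Proof.
move=> x; apply/cvgrPdist_lt => e e0.
have v0 : 0 < `|v| + 1 by rewrite ltr_wpDl.
near=> y; rewrite -dotBr.
apply: (@le_lt_trans _ _ (`|v| * `|x - y|)).
  rewrite ler_norml euclidean_dot_le andbT lerNl -dotNr.
  by rewrite -[X in _ * X]normrN euclidean_dot_le.
apply: (@le_lt_trans _ _ ((`|v| + 1) * `|x - y|)).
  by rewrite ler_wpM2r// lerDl.
rewrite mulrC -ltr_pdivlMr//; near: y.
by apply: cvgr_dist_lt => //; rewrite divr_gt0.
Unshelve. all: by end_near. Qed.

(** * Quadratic growth and the second subderivative *)

Definition quadratic_growth phi c e u v :=
  forall x, `|x - u| < e ->
    (phi u + (dot v (x - u) + c * `|x - u| ^+ 2)%R%:E <= phi x)%E.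

Lemma le_difference_quotient (y : \bar R) (r s k q : R) : 0 < k ->
  (q%:E <= (y - r%:E - s%:E) * (k^-1)%:E)%E = (r%:E + (s + q * k)%:E <= y)%E.
Proof.
move=> k0; case: y => [y| |] /=.
- by rewrite -!EFinB -EFinM -EFinD !lee_fin ler_pdivlMr//; apply/idP/idP; lra.
- by rewrite !addye// gt0_mulye ?lte_fin ?invr_gt0// !leey.
- by rewrite !addNye// gt0_mulNye ?lte_fin ?invr_gt0.
Qed.

Lemma quadratic_growth_second_subderivative phi c e u v w :
  0 < c -> 0 < e -> phi u \is a fin_num -> quadratic_growth phi c e u v ->
  ((2 * c * `|w| ^+ 2)%:E <= second_subderivative dot phi u v w)%E.
Proof.
move=> c0 e0 /fineK; move: (fine _) => r phiu qg.
rewrite /second_subderivative limf_einfE; apply/lee_subgt0Pr => d d0.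
(* On [A `*` B] the point [u + t *: w'] stays within [e] of [u], and the
   quotient exceeds the bound up to [d]. *)
pose A := [set t : R | 0 < t < e / (`|w| + 1)].
pose B := [set w' : X | `|w'| < `|w| + 1 /\
                        2 * c * `|w| ^+ 2 - d < 2 * c * `|w'| ^+ 2].
apply: (@le_trans _ _ (ereal_inf [set ((phi (u + p.1 *: p.2)%R - phi u
    - (p.1 * dot v p.2)%:E) * ((2^-1 * p.1 ^+ 2)^-1)%:E)%E | p in A `*` B])).
  apply: le_ereal_inf_tmp => _ [[t w'] /= [/andP[t0 te] [w'M w'd]] <-].
  rewrite -phiu le_difference_quotient; last by nra.
  have := qg (u + t *: w').
  rewrite (addrC u) addrK phiu normrZ gtr0_norm// dotZr.
  move=> H; apply: le_trans (H _); last first.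
    apply: lt_trans (_ : t * (`|w| + 1) < _).
      by rewrite ltr_pM2l.
    by rewrite -ltr_pdivlMr// ltr_wpDl.
  rewrite -phiu -!EFinD !lee_fin.
  have t2 : 0 < t ^+ 2 by rewrite exprn_gt0.
  nra.
apply: ereal_sup_ubound; exists (A `*` B) => //; exists (A, B) => //.
split => /=.
  near=> t; apply/andP; split; first by near: t; exact: nbhs_right_gt.
  by near: t; apply: nbhs_right_lt; rewrite divr_gt0// ltr_wpDl.
have wd : 2 * c * `|w| ^+ 2 - d < 2 * c * `|w| ^+ 2 by rewrite gtrBl.
have w1 : `|w| < `|w| + 1 by rewrite ltrDl.
have nc : (fun x : X => `|x|) @ w --> `|w| by exact: norm_continuous.
have cv : (fun x : X => 2 * c * `|x| ^+ 2) @ w --> 2 * c * `|w| ^+ 2.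
  exact: cvgM (cvg_cst _) (cvgM nc nc).
apply: filterI; [exact: (cvgr_lt _ nc _ w1)|exact: (cvgr_gt _ cv _ wd)].
Unshelve. all: by end_near. Qed.

(** Compactness of the unit sphere makes the step size uniform in the direction.
    The constant is [l / 4] because the quotients divide by [t ^+ 2 / 2] and only
    a bound strictly below [l], here [l / 2], passes from the lower limit to
    them. *)
Lemma second_subderivative_quadratic_growth phi (l : R) u v :
  0 < l -> phi u \is a fin_num ->
  (forall w, ((l * `|w| ^+ 2)%:E <= second_subderivative dot phi u v w)%E) ->
  exists2 e, 0 < e & quadratic_growth phi (l / 4) e u v.
Proof.
move=> l0 /fineK; move: (fine _) => r phiu d2.
pose P (t : R) (w : X) :=
  (phi u + (t * dot v w + l / 4 * t ^+ 2)%R%:E <= phi (u + t *: w)%R)%E.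
have : \forall t \near (0 : R)^'+, [set w : X | `|w| = 1] `<=` P t.
  apply: (iffLR (compact_near_coveringP _) (@compact_unit_sphere _ _)).
  move=> w /= w1.
  have : ((l / 2)%:E < second_subderivative dot phi u v w)%E.
    apply: lt_le_trans (d2 w); rewrite lte_fin w1 expr1n; lra.
  rewrite /second_subderivative limf_einfE => /ereal_sup_gt[_ [V FV <-]] lV.
  have [[A B] /= [nA nB] ABV] := FV.
  exists (B, A `&` [set t | 0 < t]).
    split => //=; apply: filterI => //; exact: nbhs_right_gt.
  move=> [w' t] /= [Bw' [At t0]].
  have := ltW (lt_le_trans lV
    (ereal_inf_lbound (imageP _ (ABV (t, w') (conj At Bw'))))).
  rewrite -phiu le_difference_quotient/=; last by nra.
  rewrite /P -phiu -!EFinD; congr (_ <= _)%E; congr (_%:E); by field.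
case=> e /= e0 eP; exists e => // x xu.
have [->|x0] := eqVneq x u.
  by rewrite subrr linear0r normr0 expr0n/= mulr0 addr0 adde0.
have t0 : 0 < `|x - u| by rewrite normr_gt0 subr_eq0.
have te : ball_ Num.Def.normr 0 e `|x - u|.
  by rewrite /ball_/= sub0r normrN normr_id.
have := eP _ te t0 (`|x - u|^-1 *: (x - u)).
rewrite /P /= dotZr scalerA divff ?gt_eqF// scale1r (addrC u) subrK.
rewrite mulVKf ?gt_eqF//; apply.
by rewrite normrZ normfV normr_id mulVf// gt_eqF.
Qed.

(** * Quadratic growth of convex functions *)

Lemma convex_combB (s : R) x u :
  s *: x + (1 - s) *: u - u = s *: (x - u).
Proof. by rewrite scalerBl scale1r scalerBr addrA addrAC addrK. Qed.

(** By convexity the mean slope of [phi] from [u] is nondecreasing along a ray, so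
    its value at distance [e / 2], which the growth bounds from below, controls
    it further out. *)
Lemma quadratic_growth_far phi c e u v x :
  econvex phi -> 0 < c -> 0 < e -> phi u \is a fin_num ->
  quadratic_growth phi c e u v -> e / 2 < `|x - u| ->
  (phi u + (dot v (x - u) + c * (e / 2) * `|x - u|)%R%:E <= phi x)%E.
Proof.
move=> cvx c0 e0 /fineK; move: (fine _) => r phiu qg.
move DE : `|x - u| => D De.
have D0 : 0 < D by lra.
pose s := e / 2 / D.
have s0 : 0 < s by rewrite !divr_gt0.
have s1 : s < 1 by rewrite ltr_pdivrMr// mul1r.
have sD : s * D = e / 2 by rewrite mulfVK// gt_eqF.
have := cvx x u s; rewrite s0 s1 => /(_ isT).
have := qg (s *: x + (1 - s) *: u).
rewrite convex_combB dotZr normrZ gtr0_norm// DE sD -phiu.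
move=> /(_ _)/le_trans H {}/H H.
have {}H := H ltac:(lra).
case: (phi x) H => [p| |]; last 2 first.
- by rewrite leey.
- by rewrite gt0_muleNy ?lte_fin.
rewrite -!EFinM -!EFinD !lee_fin => H.
rewrite -(ler_pM2l s0).
nra.
Qed.

(** Growth at [(u, v)] and the subgradient inequality of [(u', v')] at [u] add up
    to [c |u' - u| ^+ 2 <= <v' - v, u' - u>] when [u'] is near [u]; far from [u]
    the linear growth would give [c (e / 2) <= |v' - v|].  For [v' = v] this says
    that [v] is a subgradient at no point other than [u]. *)
Lemma quadratic_growth_calm phi c e u v u' v' :
  econvex phi -> 0 < c -> 0 < e -> phi u \is a fin_num ->
  quadratic_growth phi c e u v -> subdifferential dot phi u' v' ->
  `|v' - v| < c * (e / 2) -> c * `|u' - u| <= `|v' - v|.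
Proof.
move=> cvx c0 e0 fu qg [fu' /(_ u) sub] vv.
have far := quadratic_growth_far cvx c0 e0 fu qg.
have := qg u'; have := far u'; move: sub.
rewrite -(fineK fu) -(fineK fu') -!EFinD !lee_fin.
rewrite -(opprB u' u) dotNr.
have := euclidean_dot_le (v' - v) (u' - u); rewrite dotBl.
move: (fine _) (fine _) => r r'.
move: (dot v' _) (dot v _) => a b.
have := normr_ge0 (u' - u); have := normr_ge0 (v' - v).
move: `|u' - u| `|v' - v| vv => D N NC N0 D0 H1 H2 far' near'.
have [/near' H3|eD] := ltP D e.
  have [-> |Dn] := eqVneq D 0; first by rewrite mulr0.
  have {}D0 : 0 < D by rewrite lt_neqAle eq_sym Dn.
  by rewrite -(ler_pM2r D0); nra.
have /far' H3 : e / 2 < D by lra.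
have D1 : 0 < D by lra.
suff : c * (e / 2) <= N by lra.
by rewrite -(ler_pM2r D1); nra.
Qed.

(** A minimizer [u'] of the tilted function over the closed ball of radius [e / 2]
    minimizes it globally: outside the ball the linear growth of [phi] outweighs
    the change of tilt, and the tilted function is at least its value at the
    center. *)
Lemma quadratic_growth_subdifferential_onto phi c e u v v' :
  econvex phi -> lower_semicontinuous phi -> 0 < c -> 0 < e ->
  phi u \is a fin_num -> quadratic_growth phi c e u v ->
  `|v' - v| <= c * (e / 2) -> exists u', subdifferential dot phi u' v'.
Proof.
move=> cvx lsc c0 e0 fu qg vv.
have far := quadratic_growth_far cvx c0 e0 fu qg.
have [||u' /= u'e u'min] := lower_semicontinuous_compact_min
    (lower_semicontinuousB lsc (@dot_continuous v'))
    (_ : compact [set x : X | `|x - u| <= e / 2]).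
- exact: compact_closed_ball.
- by exists u; rewrite /= subrr normr0 divr_ge0// ltW.
have u'u : (phi u' - (dot v' u')%:E <= phi u - (dot v' u)%:E)%E.
  by apply: u'min; rewrite subrr normr0 divr_ge0// ltW.
have fu' : phi u' \is a fin_num.
  have e2 : `|u' - u| < e by lra.
  move: u'u (qg u' e2); rewrite -(fineK fu).
  by case: (phi u') => //.
exists u'; split => // x.
have := far x; have := u'min x; move: u'u; rewrite -(fineK fu) -(fineK fu').
case: (phi x) => [p| |]; last 2 first.
- by move=> *; exact: leey.
- move=> _ near' far'.
  by have [/near'|/far'] := leP `|x - u| (e / 2).
rewrite -!EFinD !lee_fin => u'u near' far'.
have := euclidean_dot_le (v' - v) (x - u); rewrite dotBl.
have := normr_ge0 (x - u); rewrite dotBr.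
have [/near'|/far'] := leP `|x - u| (e / 2); first by lra.
rewrite !dotBr; move: `|x - u| `|v' - v| vv => D N vv H1 H2 H3.
nra.
Qed.

(** * Tilted minimization and subgradients *)

Lemma subdifferential_tilt_argmin phi x0 (gamma : R) v u :
  ball x0 gamma u -> subdifferential dot phi u v ->
  tilt_argmin dot phi x0 gamma v u.
Proof.
move=> xu [fu sub]; split => // y _; have := sub y.
rewrite -(fineK fu); case: (phi y) => [p| |]; last 2 first.
- by move=> _; exact: leey.
- by [].
by rewrite -!EFinD !lee_fin dotBr; lra.
Qed.

(** The ball being open, [u] is a local, hence by convexity a global, minimizer of
    the tilted function. *)
Lemma tilt_argmin_subdifferential phi x0 (gamma : R) v u :
  econvex phi -> (forall x, -oo < phi x)%E -> (phi x0 < +oo)%E -> 0 < gamma ->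
  tilt_argmin dot phi x0 gamma v u -> subdifferential dot phi u v.
Proof.
move=> cvx phiNy phi0 g0 [xu umin].
have fx0 : phi x0 \is a fin_num by rewrite fin_numE -ltNye phiNy -ltey.
have fu : phi u \is a fin_num.
  rewrite fin_numE -ltNye phiNy -ltey/=.
  have := umin x0 (ballxx _ g0); rewrite -(fineK fx0) -EFinB.
  by case: (phi u) => // s _; rewrite ltry.
split => // x.
have : (-oo < phi x)%E by exact: phiNy.
move: fu umin => /fineK; move: (fine _) => r phiu umin.
case phix : (phi x) => [p| |]// _; last by rewrite leey.
rewrite -phiu -EFinD lee_fin.
move: xu; rewrite -ball_normE /= => xu.
(* [s] is small enough for the point [z] of the segment from [u] to [x] to stay
   in the open ball. *)
pose D := `|x - u|; have D0 : 0 <= D by exact: normr_ge0.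
pose d := gamma - `|x0 - u|; have d0 : 0 < d by rewrite subr_gt0.
have dD : 0 < d + D + 1 by lra.
pose s := d / (d + D + 1).
have s0 : 0 < s by rewrite divr_gt0.
have s1 : s < 1 by rewrite ltr_pdivrMr// mul1r; lra.
have sD : s * D < d by rewrite mulrAC ltr_pdivrMr// ltr_pM2l//; lra.
pose z := s *: x + (1 - s) *: u.
have zu : z - u = s *: (x - u) by exact: convex_combB.
have xz : ball x0 gamma z.
  rewrite -ball_normE /=.
  have -> : x0 - z = x0 - u - (z - u) by rewrite opprB addrA subrK.
  apply: le_lt_trans (ler_normB _ _) _.
  by rewrite zu normrZ gtr0_norm// -/D addrC -ltrBrDr.
have := umin z xz; have := cvx x u s; rewrite s0 s1 => /(_ isT).
rewrite -/z phix -phiu; case: (phi z) => [q| |]//.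
rewrite -!EFinM -!EFinD !lee_fin => qsp ruq.
have : dot v (z - u) = s * dot v (x - u) by rewrite zu dotZr.
rewrite !dotBr => zuE; rewrite -(ler_pM2l s0).
nra.
Qed.

(** With [u'] the solution for the tilt [v + d], the subgradient inequalities at
    [u] and [u'] give
    [phi x >= phi u + <v, x - u> + <d, x - u> - k |d| ^+ 2]; the choice
    [d = (2 k)^-1 (x - u)] maximizes the right-hand side. *)
Lemma lipschitz_quadratic_growth phi u v (k r : R) :
  0 < k -> 0 < r -> subdifferential dot phi u v ->
  (forall d, `|d| < r ->
     exists2 u', subdifferential dot phi u' (v + d) & `|u' - u| <= k * `|d|) ->
  quadratic_growth phi (4 * k)^-1 (2 * k * r) u v.
Proof.
move=> k0 r0 [fu sub] inv x xur.
have k2 : 0 < 2 * k by rewrite mulr_gt0.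
pose d := (2 * k)^-1 *: (x - u).
have dn : `|d| = (2 * k)^-1 * `|x - u| by rewrite normrZ gtr0_norm ?invr_gt0.
have [|u' [fu' sub'] u'u] := inv d; first by rewrite dn ltr_pdivrMl.
have := euclidean_dot_le d (u' - u).
have := sub' x; have := sub u'.
rewrite -(fineK fu) -(fineK fu').
case: (phi x) => [p| |]; last 2 first.
- by move=> *; exact: leey.
- by [].
rewrite -!EFinD !lee_fin.
have dx : dot d (x - u) = (2 * k)^-1 * `|x - u| ^+ 2.
  by rewrite dotZl dot_norm.
have -> : x - u' = x - u - (u' - u) by rewrite opprB addrA subrK.
rewrite dotDl !(dotBr _ _ v) (dotBr _ _ d) dx.
have d0 := normr_ge0 d.
have : `|d| * `|u' - u| <= k * `|d| ^+ 2 by nra.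
have kE : k * ((2 * k)^-1 * `|x - u|) ^+ 2 = (4 * k)^-1 * `|x - u| ^+ 2.
  by field; rewrite gt_eqF.
have kE2 : (2 * k)^-1 = (4 * k)^-1 + (4 * k)^-1 by field; rewrite gt_eqF.
rewrite dn kE kE2.
lra.
Qed.

(** * Tilt stability and uniform quadratic growth *)

Lemma tilt_stable_uniform_quadratic_growth phi xbar :
  econvex phi -> (forall x, -oo < phi x)%E -> (phi xbar < +oo)%E ->
  tilt_stable dot phi xbar ->
  exists2 c, 0 < c & exists U V : set X,
    [/\ open U, open V, U xbar, V 0 &
      forall u v, U u -> V v -> subdifferential dot phi u v ->
        exists2 e, 0 < e & quadratic_growth phi c e u v].
Proof.
move=> cvx phiNy phixbar [gamma g0 [_ [N nN [m mP mL]]]].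
have {nN} /nbhs_ballP[r /= r0 rN] := nN.
have [k k0 mk] : exists2 k : R, 0 < k &
    forall v v', N v -> N v' -> `|m v - m v'| <= k * `|v - v'|.
  case: mL => M [_ ML]; exists (`|M| + 1); first by rewrite ltr_wpDl.
  move=> v v' Nv Nv'; apply: (ML (`|M| + 1) _ (v, v')) => //.
  by rewrite (le_lt_trans (ler_norm _))// ltrDl.
have r2 : 0 < r / 2 by exact: divr_gt0.
exists (4 * k)^-1; first by rewrite invr_gt0 mulr_gt0.
(* The factor [1 / 2] leaves room for tilts [v + d] with [|d| < r / 2]. *)
exists (ball xbar gamma), (ball 0 (r / 2)); split.
- exact: ball_open.
- exact: ball_open.
- exact: ballxx.
- exact: ballxx.
move=> u v xu v0 uv.
move: v0; rewrite -ball_normE/= sub0r normrN => v0.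
have Nd d : `|d| < r / 2 -> N (v + d).
  move=> dr; apply: rN; rewrite -ball_normE/= sub0r normrN.
  apply: le_lt_trans (ler_normD _ _) _; lra.
have Nv : N v by rewrite -[v]addr0; apply: Nd; rewrite normr0.
have um : u = m v.
  have : tilt_argmin dot phi xbar gamma v u.
    exact: subdifferential_tilt_argmin.
  by rewrite mP// => ->.
exists (2 * k * (r / 2)); first by rewrite !mulr_gt0.
apply: lipschitz_quadratic_growth => // d /Nd Nvd.
exists (m (v + d)).
  apply: (tilt_argmin_subdifferential (gamma := gamma) (x0 := xbar)) => //.
  by rewrite mP.
by have := mk _ _ Nvd Nv; rewrite -um addrAC subrr add0r.
Qed.

Lemma uniform_quadratic_growth_tilt_stable phi xbar c (U V : set X) :
  econvex phi -> lower_semicontinuous phi -> (forall x, -oo < phi x)%E ->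
  subdifferential dot phi xbar 0 -> 0 < c ->
  open U -> open V -> U xbar -> V 0 ->
  (forall u v, U u -> V v -> subdifferential dot phi u v ->
     exists2 e, 0 < e & quadratic_growth phi c e u v) ->
  tilt_stable dot phi xbar.
Proof.
move=> cvx lsc phiNy sub0 c0 oU oV Ux V0 growth.
have fxbar := sub0.1.
have phixbar : (phi xbar < +oo)%E by rewrite ltey_eq fxbar.
have [e e0 qg] := growth _ _ Ux V0 sub0.
have /nbhs_ballP[a /= a0 aU] : nbhs xbar U by exact: open_nbhs_nbhs.
have /nbhs_ballP[b /= b0 bV] : nbhs 0 V by exact: open_nbhs_nbhs.
(* Tilts shorter than [r] lie in [V], have a solution, and have all their
   solutions in the ball of radius [a]. *)
have [r [r0 rb re ra]] : exists r : R,
    [/\ 0 < r, r <= b, r <= c * (e / 2) & r <= c * a].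
  exists (Num.min b (Num.min (c * (e / 2)) (c * a))).
  split; rewrite ?ge_min ?lexx ?orbT// !lt_min b0 mulr_gt0 ?divr_gt0//=.
  exact: mulr_gt0.
have rV v : `|v| < r -> V v.
  move=> vr; apply: bV.
  by rewrite -ball_normE/= sub0r normrN (lt_le_trans vr).
have /choice[m mP] : forall v, exists u,
    `|v| < r -> subdifferential dot phi u v.
  move=> v; have [vr|] := boolP (`|v| < r); last by exists 0.
  have [|u] := quadratic_growth_subdifferential_onto (v' := v) cvx lsc c0 e0
    fxbar qg.
    by rewrite subr0 (le_trans (ltW vr)).
  by exists u.
have ballu u v : `|v| < r -> subdifferential dot phi u v -> ball xbar a u.
  move=> vr uv.
  have := quadratic_growth_calm cvx c0 e0 fxbar qg uv.
  rewrite subr0 => /(_ (lt_le_trans vr re)) cu.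
  rewrite -ball_normE/= distrC -(ltr_pM2l c0).
  by apply: le_lt_trans cu (lt_le_trans vr ra).
have calm v : `|v| < r -> exists2 eta : R, 0 < eta &
    forall u' v', subdifferential dot phi u' v' -> `|v' - v| < eta ->
      `|u' - m v| <= c^-1 * `|v' - v|.
  move=> vr; have uv := mP v vr.
  have [f f0 qgv] := growth _ _ (aU _ (ballu _ _ vr uv)) (rV _ vr) uv.
  exists (c * (f / 2)) => [|u' v' uv' vv].
    by rewrite mulr_gt0// divr_gt0.
  rewrite ler_pdivlMl//.
  exact: (quadratic_growth_calm cvx c0 f0 uv.1 qgv uv').
have mE v : `|v| < r -> tilt_argmin dot phi xbar a v = [set m v].
  move=> vr; rewrite eqEsubset; split => [u uP|_ ->]; last first.
    by apply: subdifferential_tilt_argmin; [exact: ballu (mP v vr)|exact: mP].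
  have uv := tilt_argmin_subdifferential cvx phiNy phixbar a0 uP.
  have [eta eta0 /(_ _ _ uv)] := calm v vr.
  by rewrite subrr normr0 mulr0 normr_le0 subr_eq0 => /(_ eta0)/eqP.
exists a => //; split.
  rewrite mE ?normr0//; congr [set _].
  have [|eta eta0 /(_ _ _ sub0)] := calm 0; first by rewrite normr0.
  by rewrite subrr normr0 mulr0 normr_le0 subr_eq0 => /(_ eta0)/eqP.
exists (ball 0 r); first exact: nbhsx_ballx.
have ballr (v : X) : ball 0 r v = (`|v| < r) :> Prop.
  by rewrite -ball_normE/= sub0r normrN.
exists m => [v|]; first by rewrite ballr; exact: mE.
exists c^-1; split; first exact: num_real.
move=> k ck [v1 v2] /= [v1r v2r].
apply: le_trans (_ : _ <= c^-1 * `|v1 - v2|) _.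
  apply: (@klipschitz_of_pointwise _ _ _ m c^-1 (ball 0 r)) => //.
  - by rewrite invr_ge0 ltW.
  - move=> x y t; rewrite !ballr => xr yr /andP[t0 t1].
    have -> : x + t *: (y - x) = (1 - t) *: x + t *: y.
      by rewrite scalerBl scale1r scalerBr addrA addrAC.
    apply: le_lt_trans (ler_normD _ _) _; rewrite !normrZ.
    rewrite (ger0_norm t0) ger0_norm ?subr_ge0//.
    have [->|tn0] := eqVneq t 0; first by rewrite subr0 mul1r mul0r addr0.
    have {}t0 : 0 < t by rewrite lt_neqAle eq_sym tn0.
    have ty : t * `|y| < t * r by rewrite ltr_pM2l.
    have tx : (1 - t) * `|x| <= (1 - t) * r.
      by rewrite ler_wpM2l ?subr_ge0// ltW.
    lra.
  - move=> v; rewrite ballr => vr; have [eta eta0 etaP] := calm v vr.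
    exists eta => // v'; rewrite ballr => vr' vv.
    by apply: etaP => //; exact: mP.
by rewrite ler_wpM2r// ltW.
Qed.

End Euclidean.

Theorem corollary2p5 (R : realType) (X : normedVectType R)
    (dot : {dot X for idfun}) (dotE : euclidean_dot dot)
    (phi : X -> \bar R) (phi_proper : proper_fun phi)
    (phi_lsc : lower_semicontinuous phi) (phi_convex : econvex phi)
    (xbar : X) (xbar_min : minimizer phi xbar) :
  tilt_stable dot phi xbar <->
  (exists2 l : R, 0 < l &
   exists U V : set X,
     [/\ open U, open V, U xbar, V 0 &
       forall u v w : X,
         (gph_subdifferential dot phi `&` (U `*` V)) (u, v) ->
         ((l * `|w| ^+ 2)%:E <= second_subderivative dot phi u v w)%E]).
Proof.
have phiNy := phi_proper.1.
have fxbar : phi xbar \is a fin_num.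
  have [x phix] := phi_proper.2.
  rewrite fin_numE -ltNye phiNy -ltey/=.
  exact: le_lt_trans (xbar_min x) phix.
have phixbar : (phi xbar < +oo)%E by rewrite ltey_eq fxbar.
split.
- move=> /(tilt_stable_uniform_quadratic_growth dotE phi_convex phiNy phixbar).
  move=> [c c0 [U [V [oU oV Ux V0 growth]]]].
  exists (2 * c); first by rewrite mulr_gt0.
  exists U, V; split => // u v w [/= uv [/= Uu Vv]].
  have [e e0 qg] := growth u v Uu Vv uv.
  exact: quadratic_growth_second_subderivative c0 e0 uv.1 qg.
- move=> [l l0 [U [V [oU oV Ux V0 d2]]]].
  have l4 : 0 < l / 4 by rewrite divr_gt0.
  apply: (@uniform_quadratic_growth_tilt_stable _ _ _ dotE _ _ (l / 4) U V) => //.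
    by split => // x; rewrite linear0l adde0.
  move=> u v Uu Vv uv; apply: second_subderivative_quadratic_growth => //.
    exact: uv.1.
  by move=> w; exact: d2.
Qed.
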